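(* For every $\epsilon>0$ there exists a natural number $M$ such that if $m>M$, then with $k=\binom m2$ the following hold for Schubert unions in $G(2,m)$ of spanning dimension $K$. (i) If $K\le(0.36-\epsilon)k$, then the $U$ with maximal $M_U$ is maximal with respect to $g_U$, and the $U$ minimal with respect to $M_U$ is not maximal with respect to $g_U$ unless $K\le3$. (ii) If $K\ge(0.36+\epsilon)k$, then the $U$ minimal with respect to $M_U$ is maximal with respect to $g_U$, and the $U$ maximal with respect to $M_U$ is not maximal with respect to $g_U$ unless $K\ge k-3$.
   Context: Let $V$ be an $m$-dimensional vector space with basis $e_1,\dots,e_m$ and $A_i=\mathrm{Span}(e_1,\dots,e_i)$; $G(2,m)$ is the Grassmann variety of $2$-dimensional subspaces of $V$. Let $G_{G(2,m)}=\{(x,y)\in\mathbf Z^2:1\le x<y\le m\}$. For $(a,b)\in G_{G(2,m)}$ the Schubert cycle is $S_{(a,b)}=\{W:\dim(W\cap A_a)\ge1,\ W\subset A_b\}$, with grid $G_{(a,b)}=\{(x,y)\in G_{G(2,m)}:x\le a,y\le b\}$. A Schubert union $U=S_U$ is a finite (possibly empty) union of Schubert cycles $S_{\alpha_i}$, with grid $G_U=\bigcup_iG_{\alpha_i}$. Its spanning dimension is the dimension of the linear span of its affine cone in the Plücker embedding, and equals $|G_U|$; here $0\le K\le k$ is an integer. Put $g_U(q)=\sum_{(x,y)\in G_U}q^{x+y-3}$, a polynomial in $q$ (the number of points over $F_q$). $M_U=\{m_1>m_2>\dots>m_r\}\subset\{1,\dots,m-1\}$, where $m_i\ge1$ is the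 number of points of $G_U$ with $x=i$ for $i=1,\dots,r$, and there are no points with $x>r$. On the set of Schubert unions of spanning dimension $K$: the order with respect to $g_U$ is $U>V$ if $\deg g_U>\deg g_V$, or $\deg g_U=\deg g_V$ and the coefficient of $g_U$ is larger than that of $g_V$ in the largest degree where they differ (ties possible; ''maximal'' means no element is larger). The order with respect to $M_U$ is $U>V$ if the largest element of $M_U$ is larger than that of $M_V$, or these are equal and the second largest is larger, and so on. *)

(* Defs.v *)
From HB Require Import structures.
From mathcomp Require Import all_boot all_order all_algebra.
From mathcomp Require Import classical_sets reals.
Set Implicit Arguments.
Unset Strict Implicit.
Unset Printing Implicit Defensive.
Import Order.TTheory GRing.Theory Num.Theory.

Local Open Scope ring_scope.

(* The grid {(x,y) : 1 <= x < y <= m} of G(2,m). Elements of 'I_m start at 0,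
   so the pair (i,j) encodes the point x = i+1, y = j+1. *)
Notation grid_point m := {p : 'I_m * 'I_m | (p.1 < p.2)%N}.

Definition xco (m : nat) (p : grid_point m) : nat := (val p).1.+1.
Definition yco (m : nat) (p : grid_point m) : nat := (val p).2.+1.

Definition cycle_grid (m : nat) (a : grid_point m) : {set grid_point m} :=
  [set p | (xco p <= xco a)%N && (yco p <= yco a)%N]%SET.

(* A Schubert union is presented by the finite set A of the indices of its
   Schubert cycles; its grid, its points, M_U and g_U are attached to A. *)
Definition union_grid (m : nat) (A : {set grid_point m}) : {set grid_point m} :=
  (\bigcup_(a in A) cycle_grid a)%SET.

Section Geometry.
Variables (F : fieldType) (V : vectType F) (m : nat) (e : m.-tuple V).

Definition flag (i : nat) : {vspace V} := <<take i e>>%VS.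

Definition schubert_cycle (a : grid_point m) : set {vspace V} :=
  [set W | [/\ \dim W = 2%N, (1 <= \dim (W :&: flag (xco a)))%N
             & (W <= flag (yco a))%VS]]%classic.

Definition schubert_union (A : {set grid_point m}) : set {vspace V} :=
  (\bigcup_(a in [set` A]) schubert_cycle a)%classic.

(* The Pluecker coordinates of <u, v>: the 2x2 minors of the matrix of the
   coordinates of u and v in the basis e. *)
Definition pluecker (u v : V) : {ffun grid_point m -> F^o} :=
  [ffun p => coord e (val p).1 u * coord e (val p).2 v
           - coord e (val p).2 u * coord e (val p).1 v].

Definition affine_cone (U : set {vspace V}) :
    set {ffun grid_point m -> F^o} :=
  [set w | exists (W : {vspace V}) (u v : V) (c : F),
     [/\ U W, <<[:: u; v]>>%VS = W & w = c *: pluecker u v]]%classic.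

(* L is the linear span of C, that is, the least subspace containing C. *)
Definition is_linear_span (vT : vectType F) (C : set vT) (L : {vspace vT}) :
    Prop :=
  (forall w, C w -> w \in L) /\
  (forall L' : {vspace vT}, (forall w, C w -> w \in L') -> (L <= L')%VS).

Definition spanning_dim (A : {set grid_point m}) (K : nat) : Prop :=
  exists L : {vspace {ffun grid_point m -> F^o}},
    is_linear_span (affine_cone (schubert_union A)) L /\ \dim L = K.

End Geometry.

Definition g_poly (m : nat) (A : {set grid_point m}) : {poly int} :=
  \sum_(p in union_grid A) 'X^(xco p + yco p - 3).

(* g_A > g_B *)
Definition g_gt (m : nat) (A B : {set grid_point m}) : Prop :=
  (size (g_poly B) < size (g_poly A))%N \/
  size (g_poly A) = size (g_poly B) /\
  exists d : nat, (g_poly B)`_d < (g_poly A)`_d /\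
    forall d' : nat, (d < d')%N -> (g_poly A)`_d' = (g_poly B)`_d'.

Definition col_count (m : nat) (A : {set grid_point m}) (i : nat) : nat :=
  #|[set p in union_grid A | xco p == i]%SET|.

(* The list m_1, ..., m_r. It is strictly decreasing, because the grid is a
   union of cycle_grid's; hence its i-th entry (counted from 0) is the
   (i+1)-st largest element of M_U. *)
Definition M_seq (m : nat) (A : {set grid_point m}) : seq nat :=
  [seq col_count A i | i <- iota 1 m & (0 < col_count A i)%N].

(* M_A > M_B. The default value 0 is below all elements of M_A and M_B. *)
Definition M_gt (m : nat) (A B : {set grid_point m}) : Prop :=
  exists i : nat, (nth 0 (M_seq B) i < nth 0 (M_seq A) i)%N /\
    forall j : nat, (j < i)%N -> nth 0%N (M_seq A) j = nth 0%N (M_seq B) j.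

Section Extremal.
Variables (F : fieldType) (V : vectType F) (m : nat) (e : m.-tuple V).
Variable K : nat.

(* A is maximal for gt among the unions of spanning dimension K. *)
Definition maximal (gt : {set grid_point m} -> {set grid_point m} -> Prop)
    (A : {set grid_point m}) : Prop :=
  spanning_dim e A K /\ forall B, spanning_dim e B K -> ~ gt B A.

Definition g_max : {set grid_point m} -> Prop := maximal (@g_gt m).
Definition M_max : {set grid_point m} -> Prop := maximal (@M_gt m).
Definition M_min : {set grid_point m} -> Prop :=
  maximal (fun A B => M_gt B A).

End Extremal.

(* "the U with P satisfies Q": such a U exists and each one satisfies Q.
   A Schubert union can have several presentations, so A is not unique. *)
Definition the (m : nat) (P Q : {set grid_point m} -> Prop) : Prop :=
  (exists A, P A) /\ (forall A, P A -> Q A).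

(* Main.v *)
Require Import Defs.
From HB Require Import structures.
From mathcomp Require Import all_boot all_order all_algebra.
From mathcomp Require Import classical_sets reals.
From mathcomp Require Import zify lra.
Set Implicit Arguments.
Unset Strict Implicit.
Unset Printing Implicit Defensive.
Import Order.TTheory GRing.Theory Num.Theory.

Local Open Scope ring_scope.

(** A grid is a lower set of points, and the coefficients of [g_U] count its
    points on the antidiagonals [x + y = s]; call [x + y] the weight of a
    point. With [K] points, the union with maximal [M_U] fills the columns one
    after the other ([cols r t]: [r] full columns and [t] points of the next),
    and the one with minimal [M_U] fills the rows ([rows n c]).

    The largest weight decides almost everything. A union that contains the
    point [(a, b)] contains the rectangle below it, which has
    [a (2 b - a - 1) / 2] points. On an antidiagonal this is a concave
    function of [a], so it is smallest at one of the two ends [b = m] and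
    [b = a + 1], where the rectangle consists of full columns or of full rows.
    With [K = kappa k], filling [r = rho m] columns reaches the weight
    [(1 + rho) m] where [kappa = 1 - (1 - rho)^2], and filling [n = nu m] rows
    reaches [2 nu m] where [kappa = nu^2]. The two are equal when
    [5 rho^2 - 6 rho + 1 = 0], that is for [rho = 1] and for [rho = 1/5]; the
    latter is [kappa = 0.36]. Below this value columns reach higher, above it
    rows do. All that is needed of the threshold is that [5 r + 40 <= m] below
    it ([few_threshold]) and [3 m + 40 <= 5 n] above it ([many_threshold])
    when [m] is large.

    By concavity, a union that reaches the top weight [r + m] of the columns
    has to do so next to the winning end: in [(r, m)], or in [(r + 1, m - 1)]
    when the [t] extra points can pay for it ([cols_high_point]). Such unions
    can tie, so they are compared through the number [tail D s] of points of
    weight at least [s]: if it is never larger for [B] than for [A], then [B]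
    is not above [A] for the order on [g] ([not_g_gt_of_tail]). When the union
    contains [(r, m)] it has the same [r] full columns, and its other points
    have no gap in their weights, while the [t] points of the partial column
    are a chain with one point of each weight, which is the arrangement
    reaching highest ([tail_le_chain]). When it contains only
    [(r + 1, m - 1)], its points of large weight outside [cols r t] are
    matched with points of the same weight in the last row, which it misses
    ([cols_tail_le]). The situation for rows is symmetric and simpler
    ([rows_tail_le]).

    The wrong extremal union cannot reach the top weight at all, except for
    the few values of [K] at the ends of its range ([rows_wt_lt_cols],
    [cols_wt_lt_rows]). Finally, the linear span of the cone over a union
    consists of the vectors supported on its grid, so that the spanning
    dimension counts the points of the grid ([spanning_dimP]). *)

(** * Spanning dimension *)

Section SpanningDimension.
Variables (F : fieldType) (V : vectType F) (m : nat) (e : m.-tuple V).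

Definition unit_vector (p : grid_point m) : {ffun grid_point m -> F^o} :=
  [ffun q => (q == p)%:R].

Definition supported (D : {set grid_point m}) :
    {vspace {ffun grid_point m -> F^o}} :=
  <<[seq unit_vector p | p <- enum D]>>%VS.

Lemma sum_unit_vector (w : {ffun grid_point m -> F^o}) :
  w = \sum_p w p *: unit_vector p.
Proof.
apply/ffunP => q; rewrite sum_ffunE (bigD1 q) //= !ffunE eqxx.
rewrite big1 ?addr0 => [|p npq]; first by rewrite /GRing.scale /= mulr1.
by rewrite !ffunE eq_sym (negPf npq) scaler0.
Qed.

Lemma mem_supported (D : {set grid_point m}) (w : {ffun grid_point m -> F^o}) :
  (forall p, p \notin D -> w p = 0) -> w \in supported D.
Proof.
move=> w0; rewrite (sum_unit_vector w); apply: memv_suml => p _.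
have [pD|/w0 ->] := boolP (p \in D); last by rewrite scale0r mem0v.
by rewrite memvZ // memv_span // map_f // mem_enum.
Qed.

Lemma dim_supported (D : {set grid_point m}) : \dim (supported D) = #|D|.
Proof.
pose points : seq (grid_point m) := enum {: grid_point m}.
have free_all : free (map unit_vector points).
  have span_all : (fullv <= <<map unit_vector points>>)%VS.
    apply/subvP => w _; rewrite (sum_unit_vector w); apply: memv_suml => p _.
    by rewrite memvZ // memv_span // map_f // mem_enum.
  rewrite /free eqn_leq dim_span size_map -cardE /=.
  apply: leq_trans (dimvS span_all).
  by rewrite dimvf /dim /= muln1.
suff : free [seq unit_vector p | p <- enum D].
  by rewrite /free => /eqP ->; rewrite size_map -cardE.
have -> : enum D = [seq p <- points | p \in D].
  by rewrite /points /enum_mem filter_predT.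
have inj : injective unit_vector.
  move=> p q /ffunP/(_ p); rewrite !ffunE eqxx.
  by case: eqP => // _ /eqP; rewrite oner_eq0.
have -> : [seq unit_vector p | p <- points & p \in D] =
    [seq w <- [seq unit_vector p | p <- points] |
       w \in [seq unit_vector p | p <- enum D]].
  rewrite [RHS]filter_map; congr (map _ _); apply: eq_filter => p /=.
  by rewrite mem_map // mem_enum.
exact: filter_free.
Qed.

Hypothesis e_basis : basis_of {:V}%VS e.

Lemma mem_basis_flag (i : 'I_m) n : (i < n)%N -> e`_i \in flag e n.
Proof.
move=> lt_in; apply: memv_span; rewrite -(nth_take 0 lt_in).
by apply: mem_nth; rewrite size_take size_tuple; case: ifP => _.
Qed.

Lemma coord_flag0 n u (j : 'I_m) : u \in flag e n -> (n <= j)%N ->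
  coord e j u = 0.
Proof.
move=> u_flag le_nj.
have : (flag e n <= lker (linfun (coord e j : V -> F^o)))%VS.
  apply/span_subvP => v /(nthP 0) [i]; rewrite size_take size_tuple => lt_i <-.
  have lt_in : (i < n)%N by move: lt_i; case: ifP => //; lia.
  have lt_im : (i < m)%N by move: lt_i; case: ifP => //; lia.
  rewrite nth_take // memv_ker lfunE /= -[i]/(nat_of_ord (Ordinal lt_im)).
  rewrite coord_free ?(basis_free e_basis) //.
  have -> // : (Ordinal lt_im == j) = false.
  by apply/eqP => /(congr1 val) /=; lia.
by move/subvP/(_ _ u_flag); rewrite memv_ker lfunE => /eqP.
Qed.

(** A plane that meets [A_a] and lies in [A_b] has vanishing minors outside
    the grid of [(a, b)]: all coordinates of [u] and [v] vanish beyond [b], and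
    some nonzero combination of [u] and [v] lies in [A_a], so that beyond [a]
    the coordinates of [u] and [v] are proportional. *)
Lemma pluecker_supported (a : grid_point m) (W : {vspace V}) (u v : V) p :
  schubert_cycle e a W -> <<[:: u; v]>>%VS = W -> p \notin cycle_grid a ->
  pluecker e u v p = 0.
Proof.
move=> [_ meetW subW] spanW; rewrite inE negb_and -!ltnNge !ffunE.
rewrite /xco /yco !ltnS => /orP [lt_x|lt_y]; last first.
  have flagu : u \in flag e (val a).2.+1.
    by apply: (subvP subW); rewrite -spanW memv_span // !inE eqxx.
  have flagv : v \in flag e (val a).2.+1.
    by apply: (subvP subW); rewrite -spanW memv_span // !inE eqxx orbT.
  rewrite (coord_flag0 flagu lt_y) (coord_flag0 flagv lt_y).
  by rewrite mulr0 mul0r subrr.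
have [z z_meet z_neq0] : exists2 z, z \in (W :&: flag e (xco a))%VS & z != 0.
  exists (vpick (W :&: flag e (xco a))%VS); first exact: memv_pick.
  by rewrite vpick0 -dimv_eq0 -lt0n.
move: z_meet; rewrite memv_cap -spanW span_cons span_seq1 => /andP [].
case/memv_addP => _ /vlineP [c ->] [_ /vlineP [d ->] z_def] z_flag.
have rel (j : 'I_m) : (xco a <= j)%N -> c * coord e j u = - (d * coord e j v).
  move=> le_j; have := coord_flag0 z_flag le_j.
  by rewrite z_def linearD !linearZ => /eqP; rewrite addr_eq0 => /eqP.
have := valP p; rewrite /= => lt_xy.
have rel1 := rel _ lt_x; have rel2 := rel _ (ltn_trans lt_x lt_xy).
have [c0|c_neq0] := eqVneq c 0.
  have d_neq0 : d != 0.
    by apply: contraNneq z_neq0 => d0; rewrite z_def c0 d0 !scale0r addr0.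
  move: rel1 rel2; rewrite c0 !mul0r => /esym/eqP + /esym/eqP.
  rewrite !oppr_eq0 !mulf_eq0 (negPf d_neq0) /= => /eqP -> /eqP ->.
  by rewrite !mulr0 subrr.
apply: (mulfI c_neq0); rewrite mulr0 mulrBr !mulrA.
rewrite rel1 rel2 !mulNr opprK -!mulrA [X in d * X]mulrC.
by rewrite addNr.
Qed.

(** The [p]-th unit vector is the Pluecker vector of the plane spanned by the
    two basis vectors that [p] indexes. *)
Lemma unit_vector_cone (A : {set grid_point m}) p : p \in union_grid A ->
  affine_cone e (schubert_union e A) (unit_vector p).
Proof.
case/bigcupP => a aA; rewrite inE => /andP [le_x le_y].
have efree := basis_free e_basis.
have lt_ij := valP p; rewrite /= in lt_ij.
set i := (val p).1 in lt_ij; set j := (val p).2 in lt_ij.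
have neq_ij : i == j = false by apply/eqP => /(congr1 val) /=; lia.
exists <<[:: e`_i; e`_j]>>%VS, e`_i, e`_j, 1; split=> //.
  have free_ij : free [:: e`_i; e`_j].
    rewrite free_cons seq1_free span_seq1.
    rewrite (free_not0 efree) ?mem_nth ?size_tuple // andbT.
    apply/vlineP => -[c /(congr1 (coord e i))].
    rewrite linearZ /= !coord_free // eqxx eq_sym neq_ij mulr0 => /eqP.
    by rewrite oner_eq0.
  exists a; rewrite /= ?inE //; split.
  - by move: free_ij => /eqP.
  - have <- : \dim <[e`_i]> = 1%N.
      by rewrite dim_vline (free_not0 efree) ?mem_nth ?size_tuple.
    apply: dimvS; rewrite -memvE memv_cap memv_span ?inE ?eqxx //=.
    exact: mem_basis_flag.
  - apply/span_subvP => v; rewrite !inE => /orP [] /eqP ->.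
      apply: mem_basis_flag; apply: leq_trans le_y.
      exact: leq_trans lt_ij (leqnSn _).
    exact: mem_basis_flag.
rewrite scale1r; apply/ffunP => q; rewrite !ffunE !coord_free // -!natrM !mulnb.
have lt_q := valP q; rewrite /= in lt_q.
have -> : (i == (val q).2) && (j == (val q).1) = false.
  apply/andP => -[/eqP iq /eqP jq]; rewrite -iq -jq in lt_q.
  by have := ltn_trans lt_ij lt_q; rewrite ltnn.
rewrite subr0; congr (_%:R); congr nat_of_bool.
rewrite -val_eqE [val q]surjective_pairing [val p]surjective_pairing.
by rewrite xpair_eqE eq_sym [_ == (val p).2]eq_sym.
Qed.

Lemma spanning_dimP (A : {set grid_point m}) K :
  spanning_dim e A K <-> #|union_grid A| = K.
Proof.
have spanA : is_linear_span (affine_cone e (schubert_union e A))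
    (supported (union_grid A)).
  split=> [w [W [u [v [c [[a aA SaW] spanW ->]]]]]|L sub_L].
    apply: mem_supported => p p_notin; rewrite ffunE.
    rewrite (pluecker_supported SaW spanW) ?scaler0 //.
    by apply: contra p_notin => pa; apply/bigcupP; exists a.
  apply/span_subvP => _ /mapP [p pA ->]; apply: sub_L.
  by apply: unit_vector_cone; rewrite -mem_enum.
split=> [[L [[cone_L minL] <-]]|<-].
  rewrite -dim_supported; apply/eqP; rewrite eqn_leq.
  by rewrite !dimvS //; [apply: minL; case: spanA | case: spanA => _; apply].
by exists (supported (union_grid A)); rewrite dim_supported.
Qed.

End SpanningDimension.

(** * Grids of Schubert unions *)

Section Grid.
Local Open Scope nat_scope.
Variable m : nat.
Implicit Types (p q : grid_point m) (A B D R U X : {set grid_point m}).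

Definition lower D : Prop :=
  forall p q, p \in D -> (xco q <= xco p) -> (yco q <= yco p) -> q \in D.

Lemma xco_gt0 p : 0 < xco p. Proof. by []. Qed.

Lemma xco_lt_yco p : xco p < yco p. Proof. exact: valP p. Qed.

Lemma yco_le p : yco p <= m. Proof. exact: ltn_ord. Qed.

Lemma grid_point_at x y : 0 < x < y -> y <= m ->
  exists p : grid_point m, xco p = x /\ yco p = y.
Proof.
case/andP => x_gt0 lt_xy le_ym.
have ltx : (x.-1 < m) by lia.
have lty : (y.-1 < m) by lia.
have lt_p : ((Ordinal ltx, Ordinal lty).1 < (Ordinal ltx, Ordinal lty).2).
  by rewrite /=; lia.
exists (exist (fun q : 'I_m * 'I_m => (q.1 < q.2)) _ lt_p).
by rewrite /xco /yco /= !prednK //; lia.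
Qed.

Lemma grid_point_eq p q : xco p = xco q -> yco p = yco q -> p = q.
Proof.
move=> [eq1] [eq2]; apply: val_inj.
rewrite [val p]surjective_pairing [val q]surjective_pairing.
by congr (_, _); apply: val_inj.
Qed.

Lemma lower_union_grid A : lower (union_grid A).
Proof.
move=> p q /bigcupP [a aA]; rewrite inE => /andP [le_x le_y] le_xq le_yq.
apply/bigcupP; exists a => //; rewrite inE.
by rewrite (leq_trans le_xq) // (leq_trans le_yq).
Qed.

Lemma union_grid_lower D : lower D -> union_grid D = D.
Proof.
move=> lowD; apply/setP => p; apply/bigcupP/idP => [[a aD]|pD].
  by rewrite inE => /andP [le_x le_y]; apply: lowD aD _ _.
by exists p; rewrite // inE !leqnn.
Qed.

Lemma lower_at D p x y : lower D -> p \in D -> (0 < x < y) ->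
  (x <= xco p) -> (y <= yco p) ->
  exists2 q, q \in D & xco q = x /\ yco q = y.
Proof.
move=> lowD pD xy le_x le_y.
have [q [xq yq]] := grid_point_at xy (leq_trans le_y (yco_le p)).
by exists q => //; apply: lowD pD _ _; rewrite ?xq ?yq.
Qed.

Lemma card_column_segment i h : 0 < i -> h <= m ->
  #|[set p : grid_point m | (xco p == i) && (yco p <= h)]%SET| = (h - i).
Proof.
move=> i_gt0 le_hm; set S := finset _.
have inj : {in enum S &, injective (@yco m)}.
  move=> p q; rewrite !mem_enum !inE => /andP [/eqP xp _] /andP [/eqP xq _] eqy.
  by apply: grid_point_eq; rewrite ?xp ?xq.
have uniqS : uniq (map (@yco m) (enum S)).
  by rewrite map_inj_in_uniq ?enum_uniq.
rewrite cardE -(size_map (@yco m)) -[RHS](size_iota i.+1).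
apply/perm_size/uniq_perm => //; first exact: iota_uniq.
move=> y; rewrite mem_iota; apply/mapP/idP => [[p]|range_y].
  by rewrite mem_enum inE => /andP [/eqP xp le_y] ->; have := xco_lt_yco p; lia.
have [||p [xp yp]] := @grid_point_at i y; [lia|lia|].
by exists p; rewrite // mem_enum inE xp yp eqxx; lia.
Qed.

Definition col_size D i := #|[set p in D | xco p == i]%SET|.

Lemma card_col_sum D : #|D| = (\sum_(1 <= i < m.+1) col_size D i).
Proof.
rewrite -sum1_card (eq_bigr (fun p => \sum_(1 <= i < m.+1) (xco p == i))).
  rewrite exchange_big /=; apply: eq_bigr => i _.
  rewrite /col_size -sum1dep_card big_mkcondr.
  by apply: eq_bigr => p _; case: (_ == _).
move=> p _; rewrite (bigD1_seq (xco p)) ?iota_uniq ?mem_index_iota //=.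
  rewrite eqxx big1 ?addn0 // => i /negPf neq_i.
  by rewrite eq_sym neq_i.
by have := xco_lt_yco p; have := yco_le p; lia.
Qed.

Lemma card_under (h : nat -> nat) : (forall x, h x <= m) ->
  #|[set p : grid_point m | (yco p <= h (xco p))]%SET| =
    (\sum_(1 <= x < m.+1) (h x - x)).
Proof.
move=> le_h; rewrite card_col_sum; apply: eq_big_nat => i /andP [i_gt0 _].
rewrite -card_column_segment //; apply: eq_card => p; rewrite !inE andbC.
by case: eqP => //= ->.
Qed.

Lemma sum_cut (f : nat -> nat) a : (a <= m) ->
  (\sum_(1 <= x < m.+1) (if x <= a then f x else 0) =
   \sum_(1 <= x < a.+1) f x).
Proof.
move=> le_am; rewrite (@big_cat_nat _ _ _ a.+1) //=.
rewrite [X in (_ + X)]big_nat_cond [X in (_ + X)]big1 ?addn0.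
  by apply: eq_big_nat => i /andP [_]; rewrite ltnS => ->.
by move=> i; rewrite andbT => /andP [lt_ai _]; rewrite leqNgt lt_ai.
Qed.

Lemma double_sum_sub a b : (a <= b) ->
  (2 * (\sum_(1 <= x < a.+1) (b - x)) = a * (2 * b - a - 1)).
Proof.
elim: a => [|a IHa] le_ab; first by rewrite big_nil.
by rewrite big_nat_recr //= mulnDr IHa; nia.
Qed.

Lemma card_rectangle a b : a < b -> b <= m ->
  (2 * #|[set p : grid_point m | (xco p <= a) && (yco p <= b)]%SET| =
   a * (2 * b - a - 1)).
Proof.
move=> lt_ab le_bm; rewrite -double_sum_sub ?(ltnW lt_ab) //; congr (2 * _).
rewrite -(@sum_cut (fun x => b - x)); last by lia.
rewrite (eq_bigr (fun x => (if x <= a then b else 0) - x)).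
  2: by move=> x _; case: ifP.
rewrite -card_under => [|x]; last by case: ifP.
apply: eq_card => p; rewrite !inE; by case: (xco p <= a).
Qed.

Lemma card_row_segment a y : a < y -> y <= m ->
  #|[set p : grid_point m | (xco p <= a) && (yco p == y)]%SET| = a.
Proof.
move=> lt_ay le_ym; set S := finset _.
have inj : {in enum S &, injective (@xco m)}.
  move=> p q; rewrite !mem_enum !inE => /andP [_ /eqP yp] /andP [_ /eqP yq] eqx.
  by apply: grid_point_eq; rewrite ?yp ?yq.
have uniqS : uniq (map (@xco m) (enum S)).
  by rewrite map_inj_in_uniq ?enum_uniq.
rewrite cardE -(size_map (@xco m)) -[RHS](size_iota 1).
apply/perm_size/uniq_perm => //; first exact: iota_uniq.
move=> x; rewrite mem_iota; apply/mapP/idP => [[p]|range_x].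
  by rewrite mem_enum inE => /andP [le_x _] ->; have := xco_gt0 p; lia.
have [||p [xp yp]] := @grid_point_at x y; [lia|lia|].
by exists p; rewrite // mem_enum inE xp yp eqxx; lia.
Qed.

Lemma card_disjoint_parts A B D : A \subset D -> B \subset D ->
  [disjoint A & B] -> (#|A| + #|B| <= #|D|).
Proof.
move=> subA subB disj; rewrite -cardsUI.
have /eqP -> : A :&: B == finset.set0 by rewrite finset.setI_eq0.
by rewrite cards0 addn0 subset_leq_card // finset.subUset subA.
Qed.

Lemma lower_rectangle U p : lower U -> p \in U ->
  [set q | (xco q <= xco p) && (yco q <= yco p)]%SET \subset U.
Proof.
move=> lowU pU; apply/fintype.subsetP => q; rewrite inE => /andP [? ?].
exact: lowU pU _ _.
Qed.

Lemma lower_card U p : lower U -> p \in U ->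
  (xco p * (2 * yco p - xco p - 1) <= 2 * #|U|).
Proof.
move=> lowU pU; rewrite -card_rectangle ?xco_lt_yco ?yco_le //.
by rewrite leq_mul2l /= subset_leq_card // lower_rectangle.
Qed.

Lemma lower_card_row U p q : lower U -> p \in U -> q \in U ->
  (yco p < yco q) ->
  (xco p * (2 * yco p - xco p - 1) + 2 * xco q <= 2 * #|U|).
Proof.
move=> lowU pU qU lt_y; rewrite -card_rectangle ?xco_lt_yco ?yco_le //.
rewrite -{1}(card_row_segment (xco_lt_yco q) (yco_le q)) -mulnDr leq_mul2l /=.
apply: card_disjoint_parts; first exact: lower_rectangle.
  apply/fintype.subsetP => s; rewrite inE => /andP [le_x /eqP ys].
  by apply: lowU qU _ _; rewrite ?ys.
rewrite -setI_eq0; apply/eqP/setP => s; rewrite !inE.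
by apply/negbTE; move: lt_y; lia.
Qed.

Lemma lower_card_column U p q : lower U -> p \in U -> q \in U ->
  (xco p < xco q) ->
  (xco p * (2 * yco p - xco p - 1) + 2 * (yco q - xco q) <= 2 * #|U|).
Proof.
move=> lowU pU qU lt_x; rewrite -card_rectangle ?xco_lt_yco ?yco_le //.
rewrite -(card_column_segment (xco_gt0 q) (yco_le q)) -mulnDr leq_mul2l /=.
apply: card_disjoint_parts; first exact: lower_rectangle.
  apply/fintype.subsetP => s; rewrite inE => /andP [/eqP xs le_y].
  by apply: lowU qU _ _; rewrite ?xs.
rewrite -setI_eq0; apply/eqP/setP => s; rewrite !inE.
by apply/negbTE; move: lt_x; lia.
Qed.

(** * The order with respect to M *)

Lemma col_size0 D i : (m < i) -> col_size D i = 0.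
Proof.
move=> lt_mi; apply/eqP; rewrite cards_eq0; apply/eqP/setP => p; rewrite !inE.
by apply/negbTE; have := xco_lt_yco p; have := yco_le p; lia.
Qed.

(** A column of a lower set is an initial segment of the column of the full
    grid, which starts at height [xco p + 1]. *)
Lemma lower_columnP D p : lower D ->
  (p \in D) = (yco p <= xco p + col_size D (xco p)).
Proof.
move=> lowD; apply/idP/idP => [pD|].
  rewrite -leq_subLR -(card_column_segment (xco_gt0 p) (yco_le p)).
  apply: subset_leq_card; apply/fintype.subsetP => q; rewrite !inE.
  case/andP => /eqP xq le_y; rewrite xq eqxx andbT.
  by apply: lowD pD _ _; rewrite ?xq.
apply: contraTT => pD; rewrite -ltnNge -ltn_subRL.
have le_h : ((yco p).-1 <= m) by have := yco_le p; lia.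
have lt_xy := xco_lt_yco p.
suff : (col_size D (xco p) <= (yco p).-1 - xco p) by lia.
rewrite -card_column_segment //.
apply: subset_leq_card; apply/fintype.subsetP => q; rewrite !inE.
case/andP => qD /eqP xq; rewrite xq eqxx /=.
rewrite leqNgt; apply: contra pD => lt_y; apply: lowD qD _ _; rewrite ?xq //.
Qed.

Lemma lower_col_gt0 D i j : lower D -> (0 < i <= j) ->
  (0 < col_size D j) -> (0 < col_size D i).
Proof.
move=> lowD /andP [i_gt0 le_ij] /card_gt0P [p].
rewrite inE => /andP [pD /eqP xp].
have [|||q qD [xq _]] := @lower_at D p i i.+1 lowD pD;
  rewrite ?xp ?ltnSn ?i_gt0 //.
  by have := xco_lt_yco p; lia.
by apply/card_gt0P; exists q; rewrite inE qD xq eqxx.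
Qed.

Lemma nth_map_filter_iota (f : nat -> nat) k n i :
  (forall a b, k <= a <= b -> 0 < f b -> 0 < f a) ->
  (forall b, k + n <= b -> f b = 0) ->
  nth 0 [seq f j | j <- iota k n & (0 < f j)] i = f (k + i).
Proof.
elim: n k i => [|n IHn] k i down vanish /=.
  by rewrite nth_nil vanish //; lia.
have down' a b : (k.+1 <= a <= b -> 0 < f b -> 0 < f a).
  by move=> range; apply: down; lia.
have vanish' b : (k.+1 + n <= b -> f b = 0) by move=> ?; apply: vanish; lia.
case: (posnP (f k)) => [fk0|fk_gt0] /=; last first.
  by case: i => [|i] /=; rewrite ?addn0 // IHn // addSnnS.
have zero a : (k <= a) -> f a = 0.
  move=> le_ka; case: (posnP (f a)) => // fa.
  by have := down k a; rewrite leqnn le_ka fk0 => /(_ isT fa).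
by rewrite IHn // !zero //; lia.
Qed.

(** The columns of a grid that are not empty come first, so that discarding
    the empty ones does not shift the others. *)
Lemma nth_M_seq A i : nth 0 (M_seq A) i = col_size (union_grid A) i.+1.
Proof.
have lowA := @lower_union_grid A.
rewrite [LHS](@nth_map_filter_iota (col_size (union_grid A))) //.
  by move=> a b range; apply: lower_col_gt0.
by move=> b lt_mb; apply: col_size0.
Qed.

Definition col_gt A B : Prop :=
  exists i, (col_size B i.+1 < col_size A i.+1) /\
    forall j, (j < i) -> col_size A j.+1 = col_size B j.+1.

Lemma M_gtE A B : M_gt A B <-> col_gt (union_grid A) (union_grid B).
Proof.
split=> -[i [lt_i eq_i]]; exists i; move: lt_i; rewrite !nth_M_seq => lt_i.
  by split=> // j /eq_i; rewrite !nth_M_seq.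
by split=> // j /eq_i; rewrite !nth_M_seq.
Qed.

Lemma col_gt_asym A B : col_gt A B -> ~ col_gt B A.
Proof.
move=> [i [lt_i eq_i]] [j [lt_j eq_j]].
case: (ltngtP i j) => [/eq_j|/eq_i|] eq_ij; [lia|lia|].
by move: lt_i lt_j; rewrite eq_ij; lia.
Qed.

Lemma lower_col_sub A B p : lower A -> lower B -> p \in A ->
  (col_size A (xco p) <= col_size B (xco p)) -> p \in B.
Proof. by move=> lowA lowB; rewrite !lower_columnP //; lia. Qed.

Lemma col_gt_total A B : lower A -> lower B ->
  [\/ A = B, col_gt A B | col_gt B A].
Proof.
move=> lowA lowB.
have [eqAB|/forallPn [i0 neq_i0]] :=
    boolP [forall i : 'I_m, col_size A i.+1 == col_size B i.+1].
  constructor 1; apply/setP => p; rewrite !lower_columnP //.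
  by have /eqP -> := forallP eqAB (val p).1.
have ex_diff : exists i, col_size A i.+1 != col_size B i.+1 by exists i0.
case: (ex_minnP ex_diff) => i neq_i min_i.
have eq_i j : (j < i) -> col_size A j.+1 = col_size B j.+1.
  by move=> lt_ji; apply/eqP/negPn/negP => /min_i; lia.
have [lt_i|lt_i|eq_ii] := ltngtP (col_size B i.+1) (col_size A i.+1).
- by constructor 2; exists i.
- by constructor 3; exists i; split=> // j /eq_i.
- by rewrite eq_ii eqxx in neq_i.
Qed.

(** The union with maximal [M_U]; a number of points determines [r] and [t]
    once the last column begun is not full. *)
Definition cols r t : {set grid_point m} :=
  [set p | (xco p <= r) || (xco p == r.+1) && (yco p <= r.+1 + t)]%SET.

(** The union with minimal [M_U]. The row of height [y] has [y - 1] points,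
    whence [c < n] when the last row begun is not full. *)
Definition rows n c : {set grid_point m} :=
  [set p | (yco p <= n) || (yco p == n.+1) && (xco p <= c)]%SET.

Lemma lower_cols r t : lower (cols r t).
Proof.
move=> p q; rewrite !inE => mem_p le_x le_y.
by move: mem_p; lia.
Qed.

Lemma lower_rows n c : lower (rows n c).
Proof. by move=> p q; rewrite !inE; lia. Qed.

Lemma card_cols r t : (r + t < m) ->
  (2 * #|cols r t| = r * (2 * m - r - 1) + 2 * t).
Proof.
move=> lt_rt.
have -> : #|cols r t| =
    #|[set p : grid_point m | (xco p <= r) && (yco p <= m)]%SET| +
    #|[set p : grid_point m | (xco p == r.+1) && (yco p <= r.+1 + t)]%SET|.
  rewrite -cardsUI [X in (_ + X)](_ : _ = 0).
    rewrite addn0; apply: eq_card => p; rewrite !inE.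
    by rewrite yco_le andbT.
  apply/eqP; rewrite cards_eq0; apply/eqP/setP => p; rewrite !inE.
  by apply/negbTE; lia.
rewrite mulnDr card_rectangle ?card_column_segment; lia.
Qed.

Lemma card_rows n c : 0 < n -> (c <= n) -> (n + (0 < c) <= m) ->
  (2 * #|rows n c| = n * (n - 1) + 2 * c).
Proof.
move=> n_gt0 le_cn le_nm.
have -> : #|rows n c| =
    #|[set p : grid_point m | (xco p <= n.-1) && (yco p <= n)]%SET| +
    #|[set p : grid_point m | (xco p <= c) && (yco p == n.+1)]%SET|.
  rewrite -cardsUI [X in (_ + X)](_ : _ = 0).
    rewrite addn0; apply: eq_card => p; rewrite !inE.
    by have := xco_lt_yco p; lia.
  apply/eqP; rewrite cards_eq0; apply/eqP/setP => p; rewrite !inE.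
  by apply/negbTE; lia.
rewrite mulnDr card_rectangle; [|lia|lia].
case: c le_cn le_nm => [|c] le_cn le_nm; last by rewrite card_row_segment; lia.
rewrite [X in (_ + _ * X)](_ : _ = 0); first by lia.
apply/eqP; rewrite cards_eq0; apply/eqP/setP => p; rewrite !inE.
by apply/negbTE; have := xco_gt0 p; lia.
Qed.

(** If the first column where the grids differ is larger in [B], it is not
    full in [cols r t], so no later column of [cols r t] has points, and
    [cols r t] lies within [B]; having the same size, they would be equal. *)
Lemma cols_col_max r t B : lower B -> #|B| = #|cols r t| ->
  B = cols r t \/ col_gt (cols r t) B.
Proof.
move=> lowB cardB; have lowX := @lower_cols r t.
case: (col_gt_total lowB lowX) => [|[i [lt_i eq_i]]|]; [by left| |by right].
left; apply/esym/eqP; rewrite eqEcard cardB leqnn andbT.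
apply/fintype.subsetP => p pX.
have [lt_xi|lt_ix|eq_xi] := ltngtP (xco p) i.+1.
- apply: lower_col_sub lowX lowB pX _.
  by rewrite -[xco p]prednK // -eq_i //; have := xco_gt0 p; lia.
- have : (col_size B i.+1 <= col_size (cols r t) i.+1); last by lia.
  apply: subset_leq_card; apply/fintype.subsetP => q; rewrite !inE.
  by move: pX; rewrite inE; lia.
- by apply: lower_col_sub lowX lowB pX _; rewrite eq_xi; lia.
Qed.

(** If the first column where the grids differ is smaller in [B], then some
    point of [rows n c] in this column lies outside [B]. All later columns of
    [B] end strictly below it, so [B] lies within [rows n c]; having the same
    size, they would be equal. *)
Lemma rows_col_min n c B : lower B -> #|B| = #|rows n c| ->
  B = rows n c \/ col_gt B (rows n c).
Proof.
move=> lowB cardB; have lowY := @lower_rows n c.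
case: (col_gt_total lowB lowY) => [||[i [lt_i eq_i]]]; [by left|by right|].
left; apply/eqP; rewrite eqEcard cardB leqnn andbT.
have [q qY /andP [xq qB]] :
    exists2 q, q \in rows n c & (xco q == i.+1) && (q \notin B).
  have /fintype.subsetPn [q] : ~~ ([set q in rows n c | xco q == i.+1]%SET
      \subset [set q in B | xco q == i.+1]%SET).
    by apply: contraL lt_i => /subset_leq_card; rewrite -leqNgt.
  by case/setIdP => qY xq; rewrite inE xq andbT => qB; exists q; rewrite ?xq.
apply/fintype.subsetP => p pB.
have [lt_xi|lt_ix|eq_xi] := ltngtP (xco p) i.+1.
- apply: lower_col_sub lowB lowY pB _.
  by rewrite -[xco p]prednK // -eq_i //; have := xco_gt0 p; lia.
- have lt_y : (yco p < yco q).
    rewrite ltnNge; apply: contra qB => le_y.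
    by apply: lowB pB _ _; rewrite // (eqP xq) ltnW.
  by move: qY; rewrite !inE; lia.
- by apply: lower_col_sub lowB lowY pB _; rewrite eq_xi; lia.
Qed.

(** * The order with respect to g *)

Definition wt p := xco p + yco p.

Definition level D s := #|[set p in D | wt p == s]%SET|.
Definition tail D s := #|[set p in D | s <= wt p]%SET|.

Lemma coef_g_poly A d : ((g_poly A)`_d)%R = (level (union_grid A) (d + 3))%:Z.
Proof.
rewrite /g_poly coef_sum /level -sum1dep_card big_mkcondr /=.
rewrite -[RHS]natz natr_sum.
apply: eq_bigr => p _; rewrite coefXn; congr (_%:R)%R.
have := xco_lt_yco p; have := xco_gt0 p; rewrite /wt => x_gt0 lt_xy.
by case: ifP => [/eqP|/eqP] ?; case: eqP => //; lia.
Qed.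

Lemma tail_step D s : tail D s = level D s + tail D s.+1.
Proof.
rewrite /tail /level -cardsUI [X in _ + X](_ : _ = 0).
  rewrite addn0; apply: eq_card => p; rewrite !inE -andb_orr.
  by rewrite eq_sym -leq_eqVlt.
apply/eqP; rewrite cards_eq0; apply/eqP/setP => p; rewrite !inE.
by apply/negbTE; lia.
Qed.

Lemma tail0 D s : 2 * m < s -> tail D s = 0.
Proof.
move=> lt_s; apply/eqP; rewrite cards_eq0; apply/eqP/setP => p; rewrite !inE.
apply/negbTE; rewrite negb_and -ltnNge /wt.
by have := xco_lt_yco p; have := yco_le p; lia.
Qed.

Lemma g_gt_coef A B : g_gt A B -> exists d,
  ((g_poly B)`_d < (g_poly A)`_d)%R /\
  forall d', d < d' -> ((g_poly A)`_d' = (g_poly B)`_d')%R.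
Proof.
case=> [lt_size|[_ //]].
have coefB d : (size (g_poly A)).-1 <= d -> ((g_poly B)`_d = 0)%R.
  move=> le_d; apply/nth_default/(leq_trans _ le_d).
  by rewrite -ltnS (ltn_predK lt_size).
exists (size (g_poly A)).-1; split=> [|d' lt_d].
  rewrite coefB // coef_g_poly ltz_nat lt0n -eqz_nat -coef_g_poly -lead_coefE.
  by rewrite lead_coef_eq0 -size_poly_gt0 (leq_ltn_trans _ lt_size).
by rewrite coefB ?(ltnW lt_d) // nth_default // -(ltn_predK lt_size).
Qed.

(** At the largest exponent where the coefficients differ, the union that is
    larger for the order also has the larger number of points from there
    on. *)
Lemma not_g_gt_of_tail A B :
  (forall s, tail (union_grid B) s <= tail (union_grid A) s) -> ~ g_gt B A.
Proof.
move=> le_tail /g_gt_coef [d []]; rewrite !coef_g_poly ltz_nat => lt_d eq_d.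
suff eq_tail s : d + 3 < s -> tail (union_grid B) s = tail (union_grid A) s.
  have := le_tail (d + 3); rewrite 2!(tail_step _ (d + 3)) !eq_tail //; lia.
have [k] := ubnP (2 * m + 2 - s); elim: k s => // k IHk s le_k lt_s.
have [lt_ms|le_sm] := ltnP (2 * m) s; first by rewrite !tail0.
rewrite 2!(tail_step _ s) IHk; [|lia|lia].
have /eq_d : d < s - 3 by lia.
by rewrite !coef_g_poly !subnK; [case=> -> | lia].
Qed.

Lemma g_gt_of_wt A B p : p \in union_grid A ->
  (forall q, q \in union_grid B -> wt q < wt p) -> g_gt A B /\ ~ g_gt B A.
Proof.
move=> pA lt_wt; suff lt_size : size (g_poly B) < size (g_poly A).
  split=> [|[|[eq_size _]]]; [by left|by rewrite ltnNge ltnW|].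
  by rewrite eq_size ltnn in lt_size.
have := xco_lt_yco p; have := xco_gt0 p => x_gt0 lt_xy.
apply: (@leq_ltn_trans (wt p - 3)).
  apply/leq_sizeP => d le_d; rewrite coef_g_poly; congr Posz; apply/eqP.
  rewrite cards_eq0; apply/eqP/setP => q; rewrite !inE; apply/negP => /andP.
  by case=> /lt_wt lt_q /eqP eq_q; lia.
rewrite ltnNge; apply/negP => /leq_sizeP/(_ _ (leqnn _)).
rewrite coef_g_poly subnK; last by rewrite /wt; lia.
case=> /eqP; rewrite cards_eq0 => /eqP/setP/(_ p).
by rewrite !inE pA eqxx.
Qed.

Lemma card_le_wt A B : {in A &, injective wt} ->
  (forall p, p \in A -> exists2 q, q \in B & wt q = wt p) -> #|A| <= #|B|.
Proof.
move=> injA subAB; rewrite cardE [#|B|]cardE.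
rewrite -(size_map wt) -(size_map wt (enum B)).
apply: uniq_leq_size.
  rewrite map_inj_in_uniq ?enum_uniq // => p q; rewrite !mem_enum; exact: injA.
move=> s /mapP [p]; rewrite mem_enum => /subAB [q qB eq_wt] ->.
by apply/mapP; exists q; rewrite ?mem_enum.
Qed.

Lemma card_wtD D s : #|D| = #|[set p in D | wt p < s]%SET| + tail D s.
Proof.
rewrite /tail -cardsUI [X in _ + X](_ : _ = 0).
  rewrite addn0; apply: eq_card => p; rewrite !inE -andb_orr.
  by rewrite ltnNge orNb andbT.
apply/eqP; rewrite cards_eq0; apply/eqP/setP => p; rewrite !inE.
by apply/negbTE; lia.
Qed.

(** Below the weights of the points that [U] misses, [U] has all points of
    [X]; having the same size, it has at most as many points above. *)
Lemma tail_le_missing U X s : #|U| = #|X| ->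
  (forall p, p \in X -> p \notin U -> s <= wt p) -> tail U s <= tail X s.
Proof.
move=> cardUX miss; have := card_wtD U s; have := card_wtD X s.
suff : #|[set p in X | wt p < s]%SET| <= #|[set p in U | wt p < s]%SET| by lia.
apply: subset_leq_card; apply/fintype.subsetP => p; rewrite !inE.
case/andP => pX lt_p; rewrite lt_p andbT.
by apply: contraTT lt_p => /(miss p pX); rewrite -leqNgt.
Qed.

(** Points of [U] and [X] in common cancel; the others of [U] inject into
    those of [X] by their weights. *)
Lemma tail_le_exchange U X s :
  {in [set p in U | (p \notin X) && (s <= wt p)]%SET &, injective wt} ->
  (forall p, p \in U -> p \notin X -> s <= wt p ->
     exists2 q, (q \in X) && (q \notin U) & wt q = wt p) ->
  tail U s <= tail X s.
Proof.
move=> inj exch; rewrite /tail -(cardsID X) -[X in _ <= X](cardsID U).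
apply: leq_add.
  apply: subset_leq_card; apply/fintype.subsetP => p; rewrite !inE.
  by case/andP => /andP [-> ->] ->.
apply: card_le_wt => [p q|p]; rewrite !inE.
  case/and3P => pX pU le_p /and3P [qX qU le_q].
  by apply: inj; rewrite inE ?pU ?qU ?pX ?qX ?le_p ?le_q.
case/and3P => pX pU le_p; have [q /andP [qX qU] eq_wt] := exch p pU pX le_p.
by exists q; rewrite // !inE qU qX eq_wt.
Qed.

(** Among all ways of adding a given number of points to [R] such that the
    weights added have no gap above [w], a chain with one point of each weight
    from [w] on reaches highest: a set with a point of weight at least [s] has
    at least one point of each weight between [w] and [s]. *)
Lemma tail_le_chain R U X w s : R \subset U -> R \subset X -> #|U| = #|X| ->
  {in X :\: R &, injective wt} ->
  (forall p, p \in X -> p \notin R -> w <= wt p) ->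
  (forall p k, p \in U -> p \notin R -> w <= k <= wt p ->
     exists2 q, q \in U :\: R & wt q = k) ->
  tail U s <= tail X s.
Proof.
move=> subRU subRX cardUX injX geX gapless.
have [[p /setDP [pU pR] le_sp]|no_p] :=
    altP (@exists_inP _ [in U :\: R] (fun p => s <= wt p)); last first.
  apply: subset_leq_card; apply/fintype.subsetP => q; rewrite !inE.
  case/andP => qU le_q; rewrite le_q andbT.
  have [qR|qR] := boolP (q \in R); first exact: (fintype.subsetP subRX).
  move: no_p; rewrite negb_exists_in => /forall_inP/(_ q).
  by rewrite inE qU qR le_q => /(_ isT).
have := card_wtD U s; have := card_wtD X s.
suff : #|[set p in X | wt p < s]%SET| <= #|[set p in U | wt p < s]%SET| by lia.
rewrite -(cardsID R) -[X in _ <= X](cardsID R); apply: leq_add.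
  apply: subset_leq_card; apply/fintype.subsetP => q; rewrite !inE.
  by case/andP => /andP [_ ->] qR; rewrite qR (fintype.subsetP subRU).
apply: card_le_wt => [q q'|q]; rewrite !inE.
  case/and3P => qR qX _ /and3P [q'R q'X _].
  by apply: injX; rewrite inE ?qR ?q'R.
case/and3P => qR qX lt_q.
have [|q' /setDP [q'U q'R] eq_q'] := gapless p (wt q) pU pR.
  by rewrite geX //; lia.
by exists q'; rewrite // !inE q'U q'R eq_q'.
Qed.

(** From a point right of the column [r], walk left along its row down to the
    column [r + 1], then down this column: every step lowers the weight by
    one. *)
Lemma gapless_right U r p k : lower U -> p \in U -> r < xco p ->
  2 * r + 3 <= k <= wt p ->
  exists2 q, q \in U & (r < xco q) && (wt q == k).
Proof.
move=> lowU pU lt_rp /andP [le_k le_kp].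
have := xco_lt_yco p; rewrite /wt in le_kp => lt_xy.
have [le_ky|lt_yk] := leqP k (r.+1 + yco p).
  have [|||q qU [xq yq]] := @lower_at U p r.+1 (k - r.+1) lowU pU; try lia.
  by exists q; rewrite // /wt xq yq; lia.
have [|||q qU [xq yq]] := @lower_at U p (k - yco p) (yco p) lowU pU; try lia.
by exists q; rewrite // /wt xq yq; lia.
Qed.

Lemma gapless_above U n p k : lower U -> p \in U -> n < yco p ->
  0 < n -> n + 2 <= k <= wt p ->
  exists2 q, q \in U & (n < yco q) && (wt q == k).
Proof.
move=> lowU pU lt_np n_gt0 /andP [le_k le_kp].
have := xco_lt_yco p; have := xco_gt0 p; rewrite /wt in le_kp => x_gt0 lt_xy.
have [le_ky|lt_yk] := leqP k (1 + yco p).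
  have [|||q qU [xq yq]] := @lower_at U p 1 (k - 1) lowU pU; try lia.
  by exists q; rewrite // /wt xq yq; lia.
have [|||q qU [xq yq]] := @lower_at U p (k - yco p) (yco p) lowU pU; try lia.
by exists q; rewrite // /wt xq yq; lia.
Qed.

Lemma tail_le_cols U r t s : lower U -> #|U| = #|cols r t| ->
  (forall p, xco p <= r -> p \in U) -> tail U s <= tail (cols r t) s.
Proof.
move=> lowU cardU fullU.
apply: (@tail_le_chain [set p | xco p <= r]%SET _ _ (2 * r + 3)) => //.
- by apply/fintype.subsetP => p; rewrite inE; apply: fullU.
- by apply/fintype.subsetP => p; rewrite !inE => ->.
- move=> p q; rewrite !inE /wt => xp xq eq_wt.
  by apply: grid_point_eq; lia.
- by move=> p; rewrite !inE /wt; have := xco_lt_yco p; lia.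
- move=> p k pU; rewrite inE -ltnNge => lt_rp range.
  have [q qU /andP [lt_rq /eqP <-]] := gapless_right lowU pU lt_rp range.
  by exists q; rewrite // !inE qU -ltnNge lt_rq.
Qed.

Lemma tail_le_rows U n c s : lower U -> 0 < n -> #|U| = #|rows n c| ->
  (forall p, yco p <= n -> p \in U) -> tail U s <= tail (rows n c) s.
Proof.
move=> lowU n_gt0 cardU fullU.
apply: (@tail_le_chain [set p | yco p <= n]%SET _ _ (n + 2)) => //.
- by apply/fintype.subsetP => p; rewrite inE; apply: fullU.
- by apply/fintype.subsetP => p; rewrite !inE => ->.
- move=> p q; rewrite !inE /wt => xp xq eq_wt.
  by apply: grid_point_eq; lia.
- by move=> p; rewrite !inE /wt; have := xco_gt0 p; lia.
- move=> p k pU; rewrite inE -ltnNge => lt_np range.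
  have [q qU /andP [lt_nq /eqP <-]] := gapless_above lowU pU lt_np n_gt0 range.
  by exists q; rewrite // !inE qU -ltnNge lt_nq.
Qed.

(** * Few points *)

(** Moving a corner [(r, m)] along its antidiagonal by [j] steps adds
    [j (2 m - 4 r - 3 j - 1) / 2] points to the rectangle below it. This is
    concave in [j], and too much both for [j = 2] and at the far end
    [r + 2 j + 1 = m], where the excess over [5 r] in [m] makes it quadratic
    in [m]. *)
Lemma cols_rectangle_lt r t j : 5 * r + 40 <= m -> r + t + 1 < m -> 1 < j ->
  r + j < m - j ->
  r * (2 * m - r - 1) + 2 * t < (r + j) * (2 * (m - j) - (r + j) - 1).
Proof.
move=> le_rm lt_tm j_gt1 lt_j.
(* In terms of the distance [s] to the far end all subtractions disappear. *)
have [s def_m] : exists s, m = r + 2 * j + 1 + s.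
  by exists (m - (r + 2 * j + 1)); lia.
have -> : 2 * m - r - 1 = r + 4 * j + 1 + 2 * s by lia.
have -> : 2 * (m - j) - (r + j) - 1 = r + j + 1 + 2 * s by lia.
have le_t : t + 1 <= 2 * j + s by lia.
have le_r : 4 * r + 39 <= 2 * j + s by lia.
clear - j_gt1 le_t le_r; nia.
Qed.

Lemma cols_high_point U r t q : 5 * r + 40 <= m -> r + t + 1 < m -> 0 < r ->
  lower U -> #|U| = #|cols r t| -> q \in U -> r + m <= wt q -> m <= (yco q).+1.
Proof.
move=> le_rm lt_tm r_gt0 lowU cardU qU le_wt.
rewrite leqNgt; apply/negP => lt_y.
have lt_xy := xco_lt_yco q; rewrite /wt in le_wt.
have [|||p pU [xp yp]] :=
  @lower_at U q (r + (m - yco q)) (yco q) lowU qU; try lia.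
have := @cols_rectangle_lt r t (m - yco q) le_rm lt_tm.
have := lower_card lowU pU; rewrite cardU card_cols ?xp ?yp; last lia.
by rewrite subKn; lia.
Qed.

(** Without the point [(r, m)] the union contains [p0 = (r + 1, m - 1)]. Its
    points of weight above [m] that are not in [cols r t] lie in the column
    [r + 1], above the partial column of [cols r t]; they are exchanged for
    points of the last row. *)
Lemma cols_tail_le U r t s : 5 * r + 40 <= m -> r + t + 1 < m -> 0 < r ->
  lower U -> #|U| = #|cols r t| ->
  (exists2 q, q \in U & r + m <= wt q) ->
  tail U s <= tail (cols r t) s.
Proof.
move=> le_rm lt_tm r_gt0 lowU cardU [q qU le_wt].
have [/exists_inP [p pU /andP [/eqP xp /eqP yp]]|no_corner] :=
    boolP [exists p in U, (xco p == r) && (yco p == m)].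
  apply: tail_le_cols => // p' le_x.
  by apply: lowU pU _ _; rewrite ?xp ?yp ?yco_le.
have below_top p : p \in U -> r <= xco p -> yco p < m.
  move=> pU le_rx; rewrite ltn_neqAle yco_le andbT.
  apply: contra no_corner => /eqP yp.
  have [|||p' p'U [xp' yp']] := @lower_at U p r m lowU pU; try lia.
  by apply/exists_inP; exists p'; rewrite // xp' yp' !eqxx.
have le_my := cols_high_point le_rm lt_tm r_gt0 lowU cardU qU le_wt.
have lt_ym : yco q < m.
  by apply: below_top => //; have := yco_le q; rewrite /wt in le_wt; lia.
rewrite /wt in le_wt.
have [|||p0 p0U [xp0 yp0]] := @lower_at U q r.+1 m.-1 lowU qU; try lia.
have card_p0 := lower_card lowU p0U.
rewrite cardU card_cols ?xp0 ?yp0 in card_p0; last lia.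
(* The rectangle below [p0] leaves at most [r] points for the columns
   beyond. *)
have no_far p : p \in U -> r.+1 < xco p -> wt p <= m.
  move=> pU lt_x; rewrite leqNgt /wt; apply/negP => lt_m.
  have lt_xy := xco_lt_yco p.
  have le_ym : yco p < m by apply: below_top => //; lia.
  have [|||p' p'U [xp' yp']] := @lower_at U p r.+2 (yco p) lowU pU; try lia.
  have := lower_card_column lowU p0U p'U.
  rewrite xp0 yp0 xp' yp' cardU card_cols; last lia.
  by move=> /(_ (ltnSn _)); clear - le_rm lt_tm lt_xy lt_m; nia.
have [le_sm|lt_ms] := leqP s m.
  (* [U] misses points of [cols r t] in the last row only. *)
  apply: tail_le_missing => // p; rewrite inE => pX pU.
  apply: (leq_trans le_sm).
  suff yp : yco p = m by rewrite /wt yp leq_addl.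
  apply/eqP; rewrite eqn_leq yco_le leqNgt; apply: contra pU => lt_y.
  by apply: lowU p0U _ _; rewrite ?xp0 ?yp0; lia.
have shape p : p \in U -> p \notin cols r t -> s <= wt p ->
    [/\ xco p = r.+1, r.+1 + t < yco p & yco p < m].
  move=> pU; rewrite inE negb_or -ltnNge => /andP [lt_rx not_col] le_s.
  have lt_y : yco p < m by apply: below_top => //; lia.
  have xp : xco p = r.+1.
    have [le_x|lt_x] := leqP (xco p) r.+1; first by lia.
    by have := no_far p pU lt_x; lia.
  by split=> //; move: not_col; rewrite xp eqxx /= -ltnNge.
apply: tail_le_exchange => [p p'|p pU pX le_s].
  rewrite !inE => /and3P [pU pX le_p] /and3P [p'U p'X le_p'] eq_wt.
  have [|xp _ _] := shape p pU _ le_p; first by rewrite inE.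
  have [|xp' _ _] := shape p' p'U _ le_p'; first by rewrite inE.
  by apply: grid_point_eq; rewrite /wt in eq_wt; lia.
have [xp lt_y lt_ym'] := shape p pU pX le_s; rewrite /wt in le_s.
(* If the point [q'] of the same weight in the last row were in [U], the
   rectangle below [p0] and the row up to [q'] would have more than [K] points
   together. *)
have [||q' [xq' yq']] := @grid_point_at (wt p - m) m; rewrite /wt; try lia.
exists q'; last by rewrite /wt xq' yq' /wt; lia.
rewrite inE xq' /wt (_ : _ <= r) /=; last lia.
apply/negP => q'U; have := lower_card_row lowU p0U q'U.
rewrite xp0 yp0 xq' yq' cardU card_cols /wt; last lia.
rewrite prednK; last lia.
by move=> /(_ (leqnn _)); clear - le_rm lt_tm xp lt_y lt_ym' le_s; nia.
Qed.

Lemma cols_dominate U r t : 5 * r + 40 <= m -> r + t + 1 < m ->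
  lower U -> #|U| = #|cols r t| ->
  (exists2 p, p \in cols r t & forall q, q \in U -> wt q < wt p) \/
  (forall s, tail U s <= tail (cols r t) s).
Proof.
move=> le_rm lt_tm lowU cardU.
have [r0|r_gt0] := posnP r.
  by right=> s; apply: tail_le_cols => // p; rewrite r0 leqNgt xco_gt0.
have [/exists_inP high|low] := boolP [exists q in U, r + m <= wt q].
  by right=> s; apply: cols_tail_le.
left; have [||p [xp yp]] := @grid_point_at r m; [lia|lia|].
exists p => [|q qU]; first by rewrite inE xp leqnn.
by move: low; rewrite negb_exists_in ltnNge /wt xp yp => /forall_inP; apply.
Qed.

(** For [r > 0], rows that reached the weight [r + m] would reach it near
    height [m] and fill almost the whole grid. For [r = 0] the column is a
    single chain, of top weight [K + 2], which the rows only reach for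
    [K <= 3]. *)
Lemma rows_wt_lt_cols r t n c : 5 * r + 40 <= m -> r + t + 1 < m ->
  0 < n -> c < n -> n + (0 < c) <= m ->
  #|rows n c| = #|cols r t| -> 3 < #|cols r t| ->
  exists2 p, p \in cols r t & forall q, q \in rows n c -> wt q < wt p.
Proof.
move=> le_rm lt_tm n_gt0 lt_cn le_nm eq_card gt3.
have card_c := @card_cols r t; have card_r := @card_rows n c n_gt0.
rewrite eq_card card_c in card_r; [|lia].
have {card_r} card_rc := card_r (ltnW lt_cn) le_nm.
have {card_c} card_c := card_c ltac:(lia).
have [r0|r_gt0] := posnP r.
  subst r.
  have [||p [xp yp]] := @grid_point_at 1 (1 + t); [lia|lia|].
  exists p; first by rewrite inE xp yp; lia.
  move=> q; rewrite inE {2}/wt xp yp /wt.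
  have := xco_lt_yco q; have := xco_gt0 q => x_gt0 lt_xy mem_q.
  have [k def_n] : exists k, n = k + 3.
    exists (n - 3); case: (n) lt_cn card_rc => [|[|[|k]]] lt_cn card_rc; lia.
  rewrite def_n (_ : k + 3 - 1 = k + 2) in card_rc mem_q; last lia.
  have [le_y|le_x] : yco q <= k + 3 \/ yco q + xco q <= k + 4 + c by lia.
    by clear - card_rc card_c gt3 lt_xy le_y; nia.
  by clear - card_rc le_x; nia.
have [||p [xp yp]] := @grid_point_at r m; [lia|lia|].
exists p; first by rewrite inE xp yp; lia.
move=> q qY; rewrite ltnNge {1}/wt xp yp; apply/negP => le_wt.
have := cols_high_point le_rm lt_tm r_gt0 (@lower_rows n c) eq_card qY le_wt.
move: qY; rewrite inE => qY le_my.
have le_mn : m <= n + 2 by lia.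
clear - le_mn le_rm lt_tm card_rc r_gt0.
have [k def_m] : exists k, m = 5 * r + 40 + k by exists (m - (5 * r + 40)); lia.
have [l def_n] : exists l, n = 5 * r + 38 + k + l.
  by exists (n - (5 * r + 38 + k)); lia.
rewrite (_ : n - 1 = 5 * r + 37 + k + l) in card_rc; last lia.
rewrite (_ : 2 * m - r - 1 = 9 * r + 79 + 2 * k) in card_rc; last lia.
rewrite def_n in card_rc; have {lt_tm} : t < 4 * r + 40 + k by lia.
by clear - card_rc; nia.
Qed.

(** * Many points *)

(** Moving the corner [(n - 1, n)] along its antidiagonal by [j] steps adds
    [j (2 n - 3 - 3 j) / 2] points, again concave in [j] and too much both for
    [j = 2] and for the last row [j = m - n]. *)
Lemma rows_rectangle_lt n c j : 3 * m + 40 <= 5 * n -> c < n ->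
  1 < j -> j <= m - n ->
  n * (n - 1) + 2 * c < (n - 1 - j) * (2 * (n + j) - (n - 1 - j) - 1).
Proof.
move=> le_mn lt_cn j_gt1 le_j.
have [a def_n] : exists a, n = a + 1 + j by exists (n - (1 + j)); lia.
have -> : 2 * (n + j) - (n - 1 - j) - 1 = a + 1 + 4 * j by lia.
have -> : n - 1 - j = a by lia.
have -> : n - 1 = a + j by lia.
have le_ja : j + 38 <= 2 * a by lia.
have le_c : c <= a + j by lia.
rewrite def_n; clear - j_gt1 le_ja le_c; nia.
Qed.

Lemma rows_high_point U n c q :
  3 * m + 40 <= 5 * n -> c < n -> n + (0 < c) <= m ->
  lower U -> #|U| = #|rows n c| -> q \in U -> 2 * n - 1 <= wt q ->
  yco q <= n.+1.
Proof.
move=> le_mn lt_cn le_nm lowU cardU qU le_wt.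
rewrite leqNgt; apply/negP => lt_y.
have lt_xy := xco_lt_yco q; have le_ym := yco_le q; rewrite /wt in le_wt.
have [|||p pU [xp yp]] :=
  @lower_at U q (2 * n - 1 - yco q) (yco q) lowU qU; try lia.
have := @rows_rectangle_lt n c (yco q - n) le_mn lt_cn.
have := lower_card lowU pU; rewrite cardU card_rows ?xp ?yp; lia.
Qed.

(** Without the point [(n - 1, n)] the union has no point of weight above
    [2 n - 1] and contains [(n - 2, n + 1)], so it only misses points of
    weight at least [2 n - 1]. *)
Lemma rows_tail_le U n c s : 3 * m + 40 <= 5 * n -> c < n -> n + (0 < c) <= m ->
  lower U -> #|U| = #|rows n c| ->
  (exists2 q, q \in U & 2 * n - 1 <= wt q) ->
  tail U s <= tail (rows n c) s.
Proof.
move=> le_mn lt_cn le_nm lowU cardU [q qU le_wt].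
have [/exists_inP [p pU /andP [/eqP xp /eqP yp]]|no_corner] :=
    boolP [exists p in U, (xco p == n - 1) && (yco p == n)].
  apply: tail_le_rows => //; first lia.
  move=> p' le_y; apply: lowU pU _ _; rewrite ?xp ?yp //.
  by have := xco_lt_yco p'; lia.
have corner p : p \in U -> n - 1 <= xco p -> n <= yco p -> False.
  move=> pU le_x le_y; case/negP: no_corner.
  have [|||p' p'U [xp' yp']] := @lower_at U p (n - 1) n lowU pU; try lia.
  by apply/exists_inP; exists p'; rewrite // xp' yp' !eqxx.
have wt_lt p : p \in U -> wt p < 2 * n.
  move=> pU; rewrite ltnNge; apply/negP => le_p.
  have le_y : yco p <= n.+1.
    by apply: rows_high_point le_mn lt_cn le_nm lowU cardU pU _; lia.
  have := xco_lt_yco p; rewrite /wt in le_p => lt_xy.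
  by apply: corner pU _ _; lia.
have le_y : yco q <= n.+1.
  exact: rows_high_point le_mn lt_cn le_nm lowU cardU qU le_wt.
have lt_xy := xco_lt_yco q; rewrite /wt in le_wt.
have yq : yco q = n.+1.
  have [//|lt_y] := eqVneq (yco q) n.+1.
  by case: (corner q qU); lia.
have [le_s|lt_s] := leqP s (2 * n - 1).
  apply: tail_le_missing => // p; rewrite inE => pX pU; apply: (leq_trans le_s).
  rewrite /wt; have lt_p := xco_lt_yco p.
  suff : n - 2 < xco p by lia.
  rewrite ltnNge; apply: contra pU => le_x.
  by apply: lowU qU _ _; rewrite ?yq; lia.
rewrite (_ : tail U s = 0) //; apply/eqP; rewrite cards_eq0.
apply/eqP/setP => p; rewrite !inE; apply/negP => /andP [pU le_p].
by have := wt_lt p pU; lia.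
Qed.

Lemma rows_dominate U n c : 3 * m + 40 <= 5 * n -> c < n -> n + (0 < c) <= m ->
  lower U -> #|U| = #|rows n c| ->
  (exists2 p, p \in rows n c & forall q, q \in U -> wt q < wt p) \/
  (forall s, tail U s <= tail (rows n c) s).
Proof.
move=> le_mn lt_cn le_nm lowU cardU.
have [/exists_inP high|low] := boolP [exists q in U, 2 * n - 1 <= wt q].
  by right=> s; apply: rows_tail_le.
left; have [||p [xp yp]] := @grid_point_at (n - 1) n; [lia|lia|].
exists p => [|q qU]; first by rewrite inE yp leqnn.
have -> : wt p = 2 * n - 1 by rewrite /wt; lia.
by move: low; rewrite negb_exists_in ltnNge => /forall_inP; apply.
Qed.

(** Columns that reached the weight [2 n - 1] would reach it in the last row,
    so that [m <= n + 1]; then [K = k], or [r >= m - 3] and at most three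
    points are left out. *)
Lemma cols_wt_lt_rows r t n c :
  3 * m + 40 <= 5 * n -> c < n -> n + (0 < c) <= m ->
  r + t < m -> (r + t + 1 < m) || (t == 0) ->
  #|cols r t| = #|rows n c| -> 2 * #|cols r t| + 6 < m * (m - 1) ->
  exists2 p, p \in rows n c & forall q, q \in cols r t -> wt q < wt p.
Proof.
move=> le_mn lt_cn le_nm lt_rt t_small eq_card lt_card.
have n_gt0 : 0 < n by lia.
have card_r := card_rows n_gt0 (ltnW lt_cn) le_nm.
have card_c := @card_cols r t lt_rt.
rewrite -eq_card in card_r.
have [||p [xp yp]] := @grid_point_at (n - 1) n; [lia|lia|].
exists p; first by rewrite inE yp leqnn.
move=> q qX; rewrite ltnNge {1}/wt xp yp; apply/negP => le_wt.
have [q' [q'X le_q' le_x yq']] : exists q',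
    [/\ q' \in cols r t, 2 * n - 1 <= wt q', xco q' <= r & yco q' = m].
  have x_gt0 := xco_gt0 q; have lt_xy := xco_lt_yco q; have le_ym := yco_le q.
  move: qX; rewrite inE /wt in le_wt * => qX.
  have [||q' [xq' yq']] := @grid_point_at (minn (xco q) r) m; [lia|lia|].
  by exists q'; rewrite inE /wt xq' yq'; split; lia.
have := rows_high_point le_mn lt_cn le_nm (@lower_cols r t) eq_card q'X.
rewrite yq' => /(_ le_q') le_mn1; rewrite /wt yq' in le_q'.
have x_gt0 := xco_gt0 q'.
have [def_n|le_m] : n = m \/ m <= r + 3 by lia.
  by move: lt_card; rewrite card_r def_n; clear; set a := m * _; lia.
have [k def_r] : exists k, r + 3 = m + k by exists (r + 3 - m); lia.
rewrite (_ : 2 * m - r - 1 = m + 2 - k) in card_c; last lia.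
have {lt_rt} le_k : k <= 2 by lia.
by move: lt_card; rewrite card_c; clear - le_k def_r; nia.
Qed.

(** * Unions with a given number of points *)

Lemma exists_cols K : 0 < m -> 2 * K <= m * (m - 1) -> exists r t,
  [/\ r + t < m, (r + t + 1 < m) || (t == 0) & #|cols r t| = K].
Proof.
move=> m_gt0 le_K.
suff [r [t [lt_rt t_small card_rt]]] : exists r t, [/\ r + t < m,
    (r + t + 1 < m) || (t == 0) & r * (2 * m - r - 1) + 2 * t = 2 * K].
  by exists r, t; split=> //; have := card_cols lt_rt; lia.
elim: K le_K => [|K IHK] le_K; first by exists 0, 0; split; lia.
have [|r [t [lt_rt t_small card_rt]]] := IHK; first by lia.
have [lt_t|le_t] := ltnP (r + t + 2) m; first by exists r, t.+1; split; lia.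
have [def_r|lt_r] : r + 1 = m \/ r + t + 2 = m by lia.
  have t0 : t = 0 by lia.
  by move: card_rt le_K; rewrite -def_r t0; clear; nia.
exists r.+1, 0; split; [lia|lia|].
rewrite (_ : 2 * K.+1 = 2 * K + 2) -?card_rt; last lia.
rewrite -lt_r (_ : 2 * _ - r - 1 = r + 2 * t + 3); last lia.
rewrite (_ : _ - r.+1 - 1 = r + 2 * t + 2); last lia.
by clear; nia.
Qed.

Lemma exists_rows K : 0 < m -> 2 * K <= m * (m - 1) -> exists n c,
  [/\ c < n, n + (0 < c) <= m & #|rows n c| = K].
Proof.
move=> m_gt0 le_K.
suff [n [c [lt_cn le_nm card_nc]]] : exists n c, [/\ c < n,
    n + (0 < c) <= m & n * (n - 1) + 2 * c = 2 * K].
  exists n, c; split=> //; have := @card_rows n c.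
  by move=> /(_ ltac:(lia) (ltnW lt_cn) le_nm); lia.
elim: K le_K => [|K IHK] le_K; first by exists 1, 0; split; lia.
have [|n [c [lt_cn le_nm card_nc]]] := IHK; first by lia.
have lt_nm : n < m.
  rewrite ltnNge; apply/negP => le_mn; have def_n : n = m by lia.
  by move: card_nc le_K; rewrite def_n; set a := m * _; lia.
have [lt_c|le_c] := ltnP c.+1 n; first by exists n, c.+1; split; lia.
exists n.+1, 0; split; [lia|lia|].
have def_n : n = c.+1 by lia.
rewrite (_ : 2 * K.+1 = 2 * K + 2) -?card_nc; last lia.
by rewrite def_n !subn1 /=; clear; nia.
Qed.

Section Maximal.
Variables (F : fieldType) (V : vectType F) (e : m.-tuple V) (K : nat).
Hypothesis e_basis : basis_of {:V}%VS e.

Lemma spanning_dim_lower D : lower D -> spanning_dim e D K <-> #|D| = K.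
Proof. by move=> lowD; rewrite spanning_dimP // union_grid_lower. Qed.

(** A grid that beats all others of its size is the only maximal one; unions
    that differ only in their presentation have the same grid. *)
Lemma maximal_unique (gt : {set grid_point m} -> {set grid_point m} -> Prop)
    X A :
  lower X -> #|X| = K ->
  (forall B D, gt B D <-> gt (union_grid B) (union_grid D)) ->
  (forall B D, gt B D -> ~ gt D B) ->
  (forall B, lower B -> #|B| = K -> B = X \/ gt X B) ->
  maximal e K gt A <-> union_grid A = X.
Proof.
move=> lowX cardX gt_grid gt_asym X_max; have gridX := union_grid_lower lowX.
split=> [[sizeA maxA]|gridA].
  have /X_max : lower (union_grid A) by exact: lower_union_grid.
  case=> [|//|]; first exact/(spanning_dimP e_basis).
  rewrite -{1}gridX => gtXA; case: (maxA X); first exact/spanning_dim_lower.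
  by apply/gt_grid; move: gtXA; rewrite gridX.
split=> [|B sizeB]; first by apply/(spanning_dimP e_basis); rewrite gridA.
rewrite gt_grid gridA => gtBX.
have /X_max : lower (union_grid B) by exact: lower_union_grid.
case=> [|eqX|gtXB]; first exact/(spanning_dimP e_basis).
  by move: gtBX; rewrite eqX => gtXX; exact: (gt_asym _ _ gtXX).
exact: gt_asym gtBX gtXB.
Qed.

Lemma M_gt_grid A B : M_gt A B <-> M_gt (union_grid A) (union_grid B).
Proof. by rewrite !M_gtE !(union_grid_lower (@lower_union_grid _)). Qed.

Lemma M_gt_asym A B : M_gt A B -> ~ M_gt B A.
Proof. by rewrite !M_gtE; apply: col_gt_asym. Qed.

Lemma M_maxE r t A : #|cols r t| = K -> M_max e K A <-> union_grid A = cols r t.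
Proof.
move=> cardX; have lowX := @lower_cols r t.
apply: maximal_unique => // [B D|B D|B lowB cardB].
- exact: M_gt_grid.
- exact: M_gt_asym.
- by rewrite M_gtE !union_grid_lower //; apply: cols_col_max; rewrite ?cardB.
Qed.

Lemma M_minE n c A : #|rows n c| = K -> M_min e K A <-> union_grid A = rows n c.
Proof.
move=> cardX; have lowX := @lower_rows n c.
apply: maximal_unique => // [B D|B D|B lowB cardB].
- exact: M_gt_grid.
- exact: M_gt_asym.
- by rewrite M_gtE !union_grid_lower //; apply: rows_col_min; rewrite ?cardB.
Qed.

Lemma the_grid (P Q : {set grid_point m} -> Prop) X : lower X ->
  (forall A, P A <-> union_grid A = X) -> (forall A, union_grid A = X -> Q A) ->
  the P Q.
Proof.
move=> lowX PE XQ; split=> [|A /PE/XQ //].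
by exists X; apply/PE/union_grid_lower.
Qed.

(** A union of smaller largest weight has a polynomial of smaller degree; one
    with smaller tails is not above [X] either. *)
Lemma g_max_of_dominate X A : union_grid A = X -> #|X| = K ->
  (forall U, lower U -> #|U| = #|X| ->
     (exists2 p, p \in X & forall q, q \in U -> wt q < wt p) \/
     (forall s, tail U s <= tail X s)) ->
  g_max e K A.
Proof.
move=> gridA cardX X_max; split=> [|B /(spanning_dimP e_basis) cardB].
  by apply/(spanning_dimP e_basis); rewrite gridA.
have [||[p pX lt_p]|le_tail] := X_max (union_grid B).
- exact: lower_union_grid.
- by rewrite cardB.
- by have [||_ //] := @g_gt_of_wt A B p; rewrite ?gridA.
- by apply: not_g_gt_of_tail; rewrite gridA.
Qed.

Lemma not_g_max_of_wt X Y A p : union_grid A = Y -> lower X -> #|X| = K ->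
  p \in X -> (forall q, q \in Y -> wt q < wt p) -> ~ g_max e K A.
Proof.
move=> gridA lowX cardX pX lt_p [_ maxA].
apply: (maxA X); first exact/spanning_dim_lower.
by have [||//] := @g_gt_of_wt X A p; rewrite ?(union_grid_lower lowX) ?gridA.
Qed.

End Maximal.

End Grid.

(** * The threshold *)

Lemma double_bin2 m : (2 * 'C(m, 2) = m * (m - 1))%N.
Proof. by rewrite -mul_bin_diag bin1 subn1. Qed.

Lemma double_bin2R (R : realType) m :
  2%:R * 'C(m, 2)%:R = m%:R * (m%:R - 1) :> R.
Proof.
rewrite -natrM double_bin2; case: m => [|m]; first by rewrite !mul0r.
by rewrite natrM subn1 /= -natr1 addrK.
Qed.

(** With [5 r > m - 40], the [r] full columns have at least [0.36 k - O(m)]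
    points, against at most [(0.36 - eps) k]; the gap [eps k] wins since
    [eps m] is large. *)
Lemma few_threshold (R : realType) (eps : R) (m r K : nat) :
  100%:R <= eps * m%:R -> (1 < m)%N -> (r < m)%N ->
  (r * (2 * m - r - 1) <= 2 * K)%N ->
  K%:R <= (36%:R / 100%:R - eps) * 'C(m, 2)%:R ->
  (5 * r + 40 <= m)%N.
Proof.
move=> large m_gt1 lt_rm card_r few; rewrite leqNgt; apply/negP => lt_m.
have card_r' : (2 * r * m <= 2 * K + r * r + r)%N by nia.
have bin := double_bin2R R m.
have {}m_gt1 : 2 <= m%:R :> R by rewrite ler_nat.
have {}lt_rm : r%:R + 1 <= m%:R :> R by rewrite natr1 ler_nat.
have {}lt_m : m%:R <= 5 * r%:R + 39 :> R.
  by rewrite -natrM -natrD ler_nat; lia.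
have {}card_r : 2 * r%:R * m%:R <= 2 * K%:R + r%:R * r%:R + r%:R :> R.
  by rewrite -!natrM -!natrD ler_nat.
move: (m%:R) (r%:R) (K%:R) ('C(m, 2)%:R) => mu rho kappa beta
  in large few bin m_gt1 lt_rm lt_m card_r *.
have few' : 2 * kappa <= (36 / 100 - eps) * (mu * (mu - 1)).
  by rewrite -bin; lra.
have gain : 100 * (mu - 1) <= eps * mu * (mu - 1).
  by apply: ler_wpM2r => //; lra.
(* The number of points in [rho] columns increases with [rho]; it is compared
   with its value at [rho = (mu - 39) / 5]. *)
have mono : 0 <= (rho - (mu - 39) / 5) * (2 * mu - rho - (mu - 39) / 5 - 1).
  by apply: mulr_ge0; lra.
by lra.
Qed.

Lemma many_threshold (R : realType) (eps : R) (m n c K : nat) :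
  100%:R <= eps * m%:R -> (1 < m)%N -> (c < n)%N ->
  (2 * K = n * (n - 1) + 2 * c)%N ->
  (36%:R / 100%:R + eps) * 'C(m, 2)%:R <= K%:R ->
  (3 * m + 40 <= 5 * n)%N.
Proof.
move=> large m_gt1 lt_cn card_r many; rewrite leqNgt; apply/negP => lt_n.
have card_r' : (2 * K + 2 <= n * n + n)%N by nia.
have bin := double_bin2R R m.
have n_gt0 : 1 <= n%:R :> R by rewrite ler1n; lia.
have {}m_gt1 : 2 <= m%:R :> R by rewrite ler_nat.
have {}lt_n : 5 * n%:R <= 3 * m%:R + 39 :> R.
  by rewrite -!natrM -natrD ler_nat; lia.
have {}card_r : 2 * K%:R + 2 <= n%:R * n%:R + n%:R :> R.
  by rewrite -!natrM -!natrD ler_nat.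
move: (m%:R) (n%:R) (K%:R) ('C(m, 2)%:R) => mu nu kappa beta
  in large many bin m_gt1 n_gt0 lt_n card_r *.
have many' : (36 / 100 + eps) * (mu * (mu - 1)) <= 2 * kappa.
  by rewrite -bin; lra.
have gain : 100 * (mu - 1) <= eps * mu * (mu - 1).
  by apply: ler_wpM2r => //; lra.
(* Likewise for rows, at [nu = (3 * mu + 39) / 5]. *)
have mono : 0 <= ((3 * mu + 39) / 5 - nu) * ((3 * mu + 39) / 5 + nu + 1).
  by apply: mulr_ge0; lra.
by lra.
Qed.

Theorem proposition5p11 (R : realType) (eps : R) (heps : 0 < eps) :
  exists M : nat, forall m : nat, (M < m)%N ->
  forall (F : fieldType) (V : vectType F) (e : m.-tuple V),
  basis_of {:V}%VS e ->
  forall K : nat, (K <= 'C(m, 2))%N ->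
  (K%:R <= (36%:R / 100%:R - eps) * 'C(m, 2)%:R ->
     the (M_max e K) (g_max e K) /\
     ((3 < K)%N -> the (M_min e K) (fun U => ~ g_max e K U))) /\
  ((36%:R / 100%:R + eps) * 'C(m, 2)%:R <= K%:R ->
     the (M_min e K) (g_max e K) /\
     ((K + 3 < 'C(m, 2))%N -> the (M_max e K) (fun U => ~ g_max e K U))).
Proof.
have [M large] : exists M, forall m, (M < m)%N -> 100%:R <= eps * m%:R.
  exists (Num.bound (100%:R / eps)) => m lt_m.
  rewrite -ler_pdivrMl // mulrC ltW //.
  apply: lt_trans (archi_boundP _) _; first by rewrite divr_ge0 // ltW.
  by rewrite ltr_nat.
exists M.+1 => m lt_Mm F V e e_basis K le_K.
have le_2K : (2 * K <= m * (m - 1))%N by rewrite -double_bin2 leq_mul2l.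
have lt_m : (M < m)%N by exact: ltnW.
have m_gt1 : (1 < m)%N by lia.
have m_gt0 : (0 < m)%N by lia.
have [r [t [lt_rt t_small cardX]]] := exists_cols m_gt0 le_2K.
have [n [c [lt_cn le_nm cardY]]] := exists_rows m_gt0 le_2K.
have eqXY : #|cols m r t| = #|rows m n c| by rewrite cardX.
have n_gt0 : (0 < n)%N by lia.
have card_r := card_rows n_gt0 (ltnW lt_cn) le_nm.
have card_c := card_cols lt_rt.
rewrite cardX in card_c; rewrite cardY in card_r.
have maxE A := M_maxE e_basis A cardX.
have minE A := M_minE e_basis A cardY.
have lowX := @lower_cols m r t; have lowY := @lower_rows m n c.
split=> [few|many].
- have le_rm : (5 * r + 40 <= m)%N.
    by apply: (few_threshold (large m lt_m) m_gt1 _ _ few); lia.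
  have lt_tm : (r + t + 1 < m)%N by lia.
  split=> [|gt3].
    apply: (the_grid lowX maxE) => A gridA.
    apply: (g_max_of_dominate e_basis gridA cardX) => U lowU cardU.
    exact: cols_dominate.
  apply: (the_grid lowY minE) => A gridA.
  have [||p pX lt_p] := rows_wt_lt_cols le_rm lt_tm n_gt0 lt_cn le_nm.
  + by rewrite eqXY.
  + by rewrite cardX.
  exact: (not_g_max_of_wt e_basis gridA lowX cardX pX lt_p).
- have le_mn : (3 * m + 40 <= 5 * n)%N.
    exact: (many_threshold (large m lt_m) m_gt1 lt_cn _ many).
  split=> [|lt_K3].
    apply: (the_grid lowY minE) => A gridA.
    apply: (g_max_of_dominate e_basis gridA cardY) => U lowU cardU.
    exact: rows_dominate.
  apply: (the_grid lowX maxE) => A gridA.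
  have [|p pY lt_p] := cols_wt_lt_rows le_mn lt_cn le_nm lt_rt t_small eqXY.
    by rewrite cardX -double_bin2; lia.
  exact: (not_g_max_of_wt e_basis gridA lowY cardY pY lt_p).
Qed.
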